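(* Consider an instance of the Colored Knapsack Problem. Let $\boldsymbol{x}^*$ be an optimal solution to $\text{LP}_{\text{KP}}$ (the linear relaxation of the knapsack problem obtained by ignoring colors) at which the color constraint is violated for some color $\tilde c\in\mathcal{C}$, i.e., $\sum_{i\in\mathcal{I}_{\tilde c}}x^*_i>\sum_{i\in\bar{\mathcal{I}}_{\tilde c}}x^*_i+1$. Then there exists an optimal solution $\boldsymbol{x}'$ to $\text{LP}_{\text{CKP}}$ in which $\tilde c$ is critical, i.e., $\sum_{i\in\mathcal{I}_{\tilde c}}x'_i=\sum_{i\in\bar{\mathcal{I}}_{\tilde c}}x'_i+1$.
   Context: An instance of the Colored Knapsack Problem (CKP) consists of a set of items $\mathcal{I}=\{1,\dots,n\}$ with profits $p_i\in\mathbb{Z}$ (zero and negative profits allowed) and weights $w_i\in\mathbb{Z}_{>0}$, a capacity $b\in\mathbb{Z}_{>0}$ with $b<\sum_{i=1}^n w_i$, a set of colors $\mathcal{C}=\{1,\dots,m\}$, and a color $\kappa_i\in\mathcal{C}$ for each item $i$. For $c\in\mathcal{C}$ let $\mathcal{I}_c=\{i\in\mathcal{I}\mid \kappa_i=c\}$ and $\bar{\mathcal{I}}_c=\mathcal{I}\setminus\mathcal{I}_c$. $\text{LP}_{\text{KP}}$ is the linear program: maximize $\sum_{i\in\mathcal{I}}p_ix_i$ subject to $\sum_{i\in\mathcal{I}}w_ix_i\le b$ and $0\le x_i\le 1$ for all $i\in\mathcal{I}$. $\text{LP}_{\text{CKP}}$ is $\text{LP}_{\text{KP}}$ with the additional color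 constraints $\sum_{i\in\mathcal{I}_c}x_i-\sum_{i\in\bar{\mathcal{I}}_c}x_i\le 1$ for all $c\in\mathcal{C}$. Given a solution $\boldsymbol{x}\in[0,1]^n$ of $\text{LP}_{\text{CKP}}$, a color $c$ is dominant if $c\in\arg\max_{c'\in\mathcal{C}}\sum_{i\in\mathcal{I}_{c'}}x_i$; a dominant color $c$ is critical if moreover $\sum_{i\in\mathcal{I}_c}x_i-\sum_{i\in\bar{\mathcal{I}}_c}x_i=1$. *)

(* Defs.v *)
From HB Require Import structures.
From mathcomp Require Import all_boot all_order all_algebra.
From mathcomp Require Import reals.

Set Implicit Arguments.
Unset Strict Implicit.
Unset Printing Implicit Defensive.

Import Order.TTheory GRing.Theory Num.Theory.
Local Open Scope ring_scope.

(* Items and colors are indexed from 0: 'I_n and 'I_m stand for {1,...,n} and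
   {1,...,m}. The coloring need not be surjective. *)
Record ckp_instance (n m : nat) := CKPInstance {
  profit : 'I_n -> int;
  weight : 'I_n -> int;
  capacity : int;
  color : 'I_n -> 'I_m;
  weight_gt0 : forall i, 0 < weight i;
  capacity_gt0 : 0 < capacity;
  capacity_lt_sum : capacity < \sum_(i < n) weight i
}.

Definition color_items (n m : nat) (I : ckp_instance n m) (c : 'I_m) :
    {set 'I_n} :=
  [set i | color I i == c].

Definition objective (R : realType) (n m : nat) (I : ckp_instance n m)
    (x : 'rV[R]_n) : R :=
  \sum_(i < n) (profit I i)%:~R * x 0 i.

Definition lp_kp_feasible (R : realType) (n m : nat) (I : ckp_instance n m)
    (x : 'rV[R]_n) : Prop :=
  \sum_(i < n) (weight I i)%:~R * x 0 i <= (capacity I)%:~R /\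
  (forall i, 0 <= x 0 i <= 1).

Definition lp_ckp_feasible (R : realType) (n m : nat) (I : ckp_instance n m)
    (x : 'rV[R]_n) : Prop :=
  lp_kp_feasible I x /\
  (forall c : 'I_m,
    \sum_(i in color_items I c) x 0 i
    - \sum_(i in ~: color_items I c) x 0 i <= 1).

Definition lp_optimal (R : realType) (n : nat) (feasible : 'rV[R]_n -> Prop)
    (obj : 'rV[R]_n -> R) (x : 'rV[R]_n) : Prop :=
  feasible x /\ (forall y, feasible y -> obj y <= obj x).

Definition lp_kp_optimal (R : realType) (n m : nat) (I : ckp_instance n m)
    (x : 'rV[R]_n) : Prop :=
  lp_optimal (@lp_kp_feasible R n m I) (@objective R n m I) x.

Definition lp_ckp_optimal (R : realType) (n m : nat) (I : ckp_instance n m)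
    (x : 'rV[R]_n) : Prop :=
  lp_optimal (@lp_ckp_feasible R n m I) (@objective R n m I) x.

Definition dominant (R : realType) (n m : nat) (I : ckp_instance n m)
    (x : 'rV[R]_n) (c : 'I_m) : Prop :=
  forall c' : 'I_m,
    \sum_(i in color_items I c') x 0 i <= \sum_(i in color_items I c) x 0 i.

Definition critical (R : realType) (n m : nat) (I : ckp_instance n m)
    (x : 'rV[R]_n) (c : 'I_m) : Prop :=
  dominant I x c /\
  \sum_(i in color_items I c) x 0 i
  - \sum_(i in ~: color_items I c) x 0 i = 1.

(* Main.v *)
Require Import Defs.
From HB Require Import structures.
From mathcomp Require Import all_boot all_order all_algebra.
From mathcomp Require Import reals.
From mathcomp Require Import ring lra.
From mathcomp Require Import classical_sets topology normedtype derive.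

(** Write [excess c x] for the number of items of colour [c] in [x] minus the
    number of the other items, both counted fractionally; the colour constraint
    of [c] says that it is at most 1.  Let [y] be an optimal solution of the
    coloured relaxation.  It exists because the feasible set is a closed part
    of the unit cube and contains 0 ([cube_lp_max]).

    Along the segment from [y] to [xstar] the excess of [c] is affine; it is at
    most 1 at [y] and larger than 1 at [xstar], so it equals 1 at some point [z].
    Both ends satisfy the knapsack constraints, hence so does [z], and the
    profit of [z] is at least that of [y], because the profit of [xstar] is:
    [xstar] is optimal for a relaxation of the problem that [y] solves.

    The other colour constraints hold at [z] because one colour at the bound
    forces all the others below it: the items of another colour [c'] are among
    those not of colour [c], so their number is at most that of [c] minus 1
    ([color_sum_other]).  Hence the excess of [c'] is at most -1
    ([other_excess]), and [c] is dominant ([excess_eq1_critical]).  So [z] is feasible, optimal, and [c] is critical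
    in it. *)

Set Implicit Arguments.
Unset Strict Implicit.
Unset Printing Implicit Defensive.

Import Order.TTheory GRing.Theory Num.Theory.
Import numFieldNormedType.Exports.
Local Open Scope ring_scope.

Definition linear_form (R : realType) (n : nat) (a : 'I_n -> R)
    (x : 'rV[R]_n) : R :=
  \sum_(i < n) a i * x 0 i.

Lemma linear_form_segment (R : realType) (n : nat) (a : 'I_n -> R) (t : R)
    (x y : 'rV[R]_n) :
  linear_form a ((1 - t) *: x + t *: y)
  = (1 - t) * linear_form a x + t * linear_form a y.
Proof.
rewrite /linear_form !mulr_sumr -big_split /=.
by apply: eq_bigr => i _; rewrite !mxE; ring.
Qed.

Lemma linear_form_continuous (R : realType) (n : nat) (a : 'I_n -> R) :
  continuous (linear_form a).
Proof.
apply: (continuous_big (@add_continuous R)) => i _ x.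
by apply: continuousM; [exact: cst_continuous | exact: coord_continuous].
Qed.

(** The feasible set is a closed subset of the compact cube, so the extreme
    value theorem applies: each constraint confines [x] to the preimage of a
    closed half-line under a continuous map, and an intersection of closed sets,
    over any index type, is closed. *)
Lemma cube_lp_max (R : realType) (n : nat) (J : Type) (a : J -> 'I_n -> R)
    (b : J -> R) (p : 'I_n -> R) (x0 : 'rV[R]_n) :
  let feasible x :=
    (forall j, linear_form (a j) x <= b j) /\ (forall i, 0 <= x 0 i <= 1) in
  feasible x0 -> exists x, lp_optimal feasible (linear_form p) x.
Proof.
move=> feasible x0F.
have cF : compact (feasible : set 'rV[R]_n).
  pose halfspaces := (\bigcap_j (linear_form (a j) @^-1` [set r | r <= b j]))%classic.
  pose cube := [set x : 'rV[R]_n | forall i, x ord0 i \in `[0, 1]%R]%classic.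
  have -> : (feasible : set 'rV[R]_n) = (cube `&` halfspaces)%classic.
    apply/seteqP; split=> x /=.
      by move=> [xa x01]; split=> [i|j _]; [rewrite /= in_itv /= x01 | exact: xa].
    move=> [x01 xa]; split=> [j|i]; first exact: xa.
    by have := x01 i; rewrite /= in_itv.
  have cube_compact : compact cube.
    apply: (@rV_compact R n (fun=> `[0, 1]%classic)) => _.
    exact: segment_compact.
  apply: compact_closedI cube_compact _.
  apply: closed_bigI => j _.
  apply: preimage_closed (@closed_le _ _) => x _.
  exact: linear_form_continuous.
have cp : {within feasible, continuous (linear_form p)}%classic.
  by apply: continuous_subspaceT; exact: linear_form_continuous.
have [x xF xmax] := EVT_max_rV (ex_intro _ x0 x0F) cF cp.
by exists x; split=> [|y yF]; [rewrite inE in xF | apply: xmax; rewrite inE].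
Qed.

Section ColorExcess.
Variables (R : realType) (n m : nat) (I : ckp_instance n m).
Implicit Types (x : 'rV[R]_n) (c : 'I_m).

Definition excess_coef c (i : 'I_n) : R := if color I i == c then 1 else -1.

(** A signed sum over all items, rather than a difference of two sums, so that
    all the constraints and the objective are linear forms of the same shape. *)
Definition excess c x : R := linear_form (excess_coef c) x.

Lemma excessE c x :
  excess c x =
  \sum_(i in color_items I c) x 0 i - \sum_(i in ~: color_items I c) x 0 i.
Proof.
rewrite /excess /linear_form (bigID (mem (color_items I c))) /= -sumrN.
congr (_ + _); first by apply: eq_bigr => i; rewrite inE /excess_coef => ->; rewrite mul1r.
apply: eq_big => i; first by rewrite !inE.
by rewrite inE /excess_coef => /negbTE ->; rewrite mulN1r.
Qed.

Lemma color_sum_other x c c' :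
  (forall i, 0 <= x 0 i) -> c' != c ->
  \sum_(i in color_items I c') x 0 i <= \sum_(i in ~: color_items I c) x 0 i.
Proof.
move=> x0 c'c; rewrite [leRHS](big_setID (color_items I c')) /=.
have -> : ~: color_items I c :&: color_items I c' = color_items I c'.
  by apply/finset.setIidPr/fintype.subsetP => i; rewrite !inE => /eqP ->.
by rewrite lerDl sumr_ge0.
Qed.

(** At most one colour can hold a majority: by [color_sum_other] in both
    directions, the items of [c'] number at most those not of [c], and the items
    of [c] at most those not of [c']. *)
Lemma other_excess x c c' :
  (forall i, 0 <= x 0 i) -> c' != c -> excess c' x <= - excess c x.
Proof.
move=> x0 c'c; rewrite !excessE.
have := color_sum_other x0 c'c; rewrite eq_sym in c'c.
by have := color_sum_other x0 c'c; lra.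
Qed.

Lemma excess_eq1_critical x c :
  (forall i, 0 <= x 0 i) -> excess c x = 1 -> critical I x c.
Proof.
rewrite excessE => x0 ex1; split=> // c'.
have [-> //|c'c] := eqVneq c' c.
by have := color_sum_other x0 c'c; lra.
Qed.

Lemma lp_ckp_feasibleE x :
  lp_ckp_feasible I x <->
  lp_kp_feasible I x /\ (forall c, excess c x <= 1).
Proof. by split=> -[xkp xc]; split=> // c; have := xc c; rewrite excessE. Qed.

(** The point 0 is feasible because the capacity is nonnegative. *)
Lemma lp_ckp_optimal_exists : exists x : 'rV[R]_n, lp_ckp_optimal I x.
Proof.
(* [None] indexes the knapsack constraint, [Some c] the constraint of [c] *)
pose a (j : option 'I_m) : 'I_n -> R :=
  if j is Some c then excess_coef c else fun i => (weight I i)%:~R.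
pose b (j : option 'I_m) : R := if j is Some _ then 1 else (capacity I)%:~R.
pose F x := (forall j, linear_form (a j) x <= b j) /\ (forall i, 0 <= x 0 i <= 1).
have FE x : lp_ckp_feasible I x <-> F x.
  rewrite lp_ckp_feasibleE; split=> [[[xw x01] xc]|[xa x01]].
    by split=> // -[c|]; [exact: xc | exact: xw].
  by split=> [|c]; [split=> //; exact: xa None | exact: xa (Some c)].
have F0 : F 0.
  split=> [j|i]; last by rewrite mxE lexx ler01.
  rewrite /linear_form big1 => [|i _]; last by rewrite mxE mulr0.
  by case: j => [c|] /=; rewrite ?ler01 // ler0z ltW // capacity_gt0.
have [x [xF xmax]] := cube_lp_max (fun i => (profit I i)%:~R) F0.
by exists x; split=> [|y /FE yF]; [exact/FE | exact: xmax].
Qed.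

Lemma lp_kp_feasible_segment (t : R) x y : 0 <= t <= 1 ->
  lp_kp_feasible I x -> lp_kp_feasible I y ->
  lp_kp_feasible I ((1 - t) *: x + t *: y).
Proof.
move=> t01 [xw x01] [yw y01]; split=> [|i].
  by have := linear_form_segment (fun i => (weight I i)%:~R) t x y;
     rewrite /linear_form => ->; nra.
by have := x01 i; have := y01 i; rewrite !mxE; nra.
Qed.

End ColorExcess.

Theorem lemma2 (R : realType) (n m : nat) (I : ckp_instance n m)
    (xstar : 'rV[R]_n) (c : 'I_m)
    (xstar_opt : lp_kp_optimal I xstar)
    (c_violated : \sum_(i in color_items I c) xstar 0 i
                  > \sum_(i in ~: color_items I c) xstar 0 i + 1) :
  exists x' : 'rV[R]_n, lp_ckp_optimal I x' /\ critical I x' c.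
Proof.
have [y [/lp_ckp_feasibleE[ykp yc] ymax]] := lp_ckp_optimal_exists R I.
have [xkp xmax] := xstar_opt.
have ex_x : 1 < excess I c xstar by rewrite excessE; lra.
have ex_y := yc c.
(* the parameter at which the affine excess of [c] takes the value 1 *)
pose t := (1 - excess I c y) / (excess I c xstar - excess I c y).
have tE : t * (excess I c xstar - excess I c y) = 1 - excess I c y.
  by rewrite divfK // gt_eqF //; lra.
have t01 : 0 <= t <= 1 by apply/andP; split; [apply: divr_ge0; lra | rewrite ler_pdivrMr; lra].
pose z := (1 - t) *: y + t *: xstar.
have zkp : lp_kp_feasible I z by exact: lp_kp_feasible_segment.
have z0 i : 0 <= z 0 i by have /andP[] := zkp.2 i.
have zc : excess I c z = 1 by rewrite /excess linear_form_segment -!/(excess _ _ _); lra.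
exists z; split; last exact: excess_eq1_critical.
split=> [|u uF].
  apply/lp_ckp_feasibleE; split=> // c'.
  have [->|c'c] := eqVneq c' c; first by rewrite zc.
  by have := other_excess I z0 c'c; rewrite zc; lra.
apply: le_trans (ymax u uF) _.
have -> : objective I z = (1 - t) * objective I y + t * objective I xstar.
  exact: linear_form_segment.
by have := xmax y ykp; nra.
Qed.
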